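(* Let $f \in \mathbb{R}[x,y]_{2d}$ be a nonnegative binary form of degree $2d$. Let $F$ be a polyhedral face of the Hermitian Gram spectrahedron $\mathcal{H}^{+}(f)$ of dimension $k$. Then $\binom{k+1}{2} \leq d$. Moreover, if all vertices of $F$ are rank-one tensors, then $F$ is a simplex.
   Context: $\mathbb{K}[x,y]_m$ denotes the space of binary forms of degree $m$ over $\mathbb{K}$ (together with $0$). A form $f\in\mathbb{R}[x,y]_{2d}$ is nonnegative if $f(a,b)\ge 0$ for all $(a,b)\in\mathbb{R}^2$. Let $V=\mathbb{C}[x,y]_d$ and let $p\mapsto\overline{p}$ be complex conjugation of coefficients. Let $\mathsf{H}_2V$ be the real vector space of Hermitian tensors, i.e. the elements of $V\otimes_{\mathbb{C}}\overline{V}$ fixed by the antilinear involution $v\otimes\overline{w}\mapsto w\otimes\overline{v}$. Let $\mu:\mathsf{H}_2V\to\mathbb{C}[x,y]_{2d}$ be the $\mathbb{R}$-linear map induced by $p\otimes\overline{q}\mapsto p\overline{q}$. Every $\theta\in\mathsf{H}_2V$ can be written as $\theta=\sum_{j=1}^r\epsilon_j\, p_j\otimes\overline{p_j}$ with $\epsilon_j=\pm1$ and $p_1,\dots,p_r\in V$ linearly independent over $\mathbb{C}$; then $\mathrm{rk}(\theta)=r$, and $\theta$ is positive semidefinite (psd) if all $\epsilon_j=1$. The Hermitian Gram spectrahedron is $\mathcal{H}^{+}(f)=\{\theta\in\mathsf{H}_2V:\theta\text{ psd},\ \mu(\theta)=f\}$, a compact convex set. A face of it is polyhedral if it is a (nonempty)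 polyhedron; its vertices are its extreme points. *)

(* Defs.v *)
From HB Require Import structures.
From mathcomp Require Import all_boot all_order all_algebra.
From mathcomp Require Import boolp classical_sets reals convex.
From mathcomp Require Import complex mpoly.

Set Implicit Arguments.
Unset Strict Implicit.
Unset Printing Implicit Defensive.

Import Order.TTheory GRing.Theory Num.Theory.

Local Open Scope classical_set_scope.
Local Open Scope ring_scope.

Section ConvexGeometry.
Variables (R : realType) (E : lmodType R).
Implicit Types (A F K P : set E).

Definition aff_hull A : set E :=
  [set x | exists n (v : 'I_n -> E) (c : 'I_n -> R),
     [/\ forall i, A (v i), \sum_i c i = 1 & x = \sum_i c i *: v i]].

Definition conv_hull A : set E :=
  [set x | exists n (v : 'I_n -> E) (c : 'I_n -> R),
     [/\ forall i, A (v i), forall i, 0 <= c i, \sum_i c i = 1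
       & x = \sum_i c i *: v i]].

Definition aff_indep n (v : 'I_n -> E) : Prop :=
  forall c : 'I_n -> R,
    \sum_i c i = 0 -> \sum_i c i *: v i = 0 -> forall i, c i = 0.

(* The affine hull of A has an affine frame of k + 1 points. *)
Definition has_dim A (k : nat) : Prop :=
  exists v : 'I_k.+1 -> E,
    aff_indep v /\ aff_hull A = aff_hull (range v).

(* The empty set is a face under this definition, as is K itself; proper faces
   need not be exposed. *)
Definition is_face K F : Prop :=
  [/\ F `<=` K, convex_set F
    & forall x y (t : R), K x -> K y -> 0 < t -> t < 1 ->
        F ((1 - t) *: x + t *: y) -> F x /\ F y].

Definition polyhedron P : Prop :=
  exists n (l : 'I_n -> {scalar E}) (b : 'I_n -> R),
    P = [set x | forall i, l i x <= b i].

Definition polyhedral_face K F : Prop :=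
  [/\ is_face K F, polyhedron F & F !=set0].

Definition extreme_points A : set E :=
  [set x | A x /\ forall y z (t : R), A y -> A z -> 0 < t -> t < 1 ->
             x = (1 - t) *: y + t *: z -> y = x /\ z = x].

Definition is_simplex A : Prop :=
  exists n (v : 'I_n.+1 -> E), aff_indep v /\ A = conv_hull (range v).

End ConvexGeometry.

Section HermitianTensors.
Variables (R : realType) (d : nat).
Local Notation C := R[i].

Definition cform : Type := dhomog 2 C d.
HB.instance Definition _ := Vector.on cform.

Definition bmon (i : 'I_d.+1) : 'X_{1..2} := [multinom of [:: val i; (d - i)%N]].

Definition conj_form (p : {mpoly C[2]}) : {mpoly C[2]} := map_mpoly Num.conj p.

(* V (x) conj V is encoded by matrices: A stands for the tensor
   \sum_(i, j) A i j 'X_[bmon i] (x) conj 'X_[bmon j]. *)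
Definition tens (p q : cform) : 'M[C]_d.+1 :=
  \matrix_(i, j) ((val p)@_(bmon i) * ((val q)@_(bmon j))^*).

Definition mu (A : 'M[C]_d.+1) : {mpoly C[2]} :=
  \sum_i \sum_j A i j *: ('X_[bmon i] * 'X_[bmon j]).

Fact mu_is_linear : linear mu.
Proof.
move=> a A B; rewrite /mu scaler_sumr -big_split /=; apply: eq_bigr => i _.
rewrite scaler_sumr -big_split /=; apply: eq_bigr => j _.
by rewrite !mxE scalerDl scalerA.
Qed.
HB.instance Definition _ :=
  GRing.isLinear.Build C 'M[C]_d.+1 {mpoly C[2]} _ mu mu_is_linear.

Lemma bmon_inj : injective bmon.
Proof. by move=> i j /mnmP/(_ ord0); rewrite !multinomE !(tnth_nth 0%N) => /val_inj. Qed.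

Lemma cformE (p : cform) : val p = \sum_i (val p)@_(bmon i) *: 'X_[bmon i].
Proof.
apply/mpolyP => m; rewrite raddf_sum /=.
under eq_bigr do rewrite mcoeffZ mcoeffX.
have [md|md] := eqVneq (mdeg m) d; last first.
  rewrite (dhomog_nemf_coeff (valP p) md) big1 // => i _.
  case: eqP => [e|_]; last by rewrite mulr0.
  case/eqP: md; rewrite -e mdegE big_ord_recl big_ord1 !multinomE /=.
  by rewrite !(tnth_nth 0%N) /= subnKC // leq_ord.
have mE : (m ord0 + m (lift ord0 ord0))%N = d.
  by rewrite -md mdegE big_ord_recl big_ord1.
have m0 : (m ord0 < d.+1)%N by rewrite ltnS -mE leq_addr.
have -> : m = bmon (Ordinal m0).
  apply/mnmP => k; rewrite multinomE; case: k => [[|[|k]] hk] //=.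
    by congr (m _); apply/val_inj.
  rewrite (tnth_nth 0%N) /= -{1}mE addKn; congr (m _); exact/val_inj.
rewrite (bigD1 (Ordinal m0)) //= eqxx mulr1 big1 ?addr0 // => i ni.
by rewrite (inj_eq bmon_inj) (negbTE ni) mulr0.
Qed.

Lemma mu_tens (p q : cform) : mu (tens p q) = val p * conj_form (val q).
Proof.
have -> : conj_form (val q) = \sum_j ((val q)@_(bmon j))^* *: 'X_[bmon j].
  rewrite /conj_form {1}cformE raddf_sum /=; apply: eq_bigr => j _.
  by rewrite map_mpolyZ map_mpolyX.
rewrite {1}(cformE p) mulr_suml; apply: eq_bigr => i _.
rewrite mulr_sumr; apply: eq_bigr => j _.
by rewrite mxE -scalerAl -scalerAr scalerA.
Qed.

(* The involution v (x) conj w |-> w (x) conj v is conjugate transposition. *)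
Lemma tens_adjoint (p q : cform) : map_mx Num.conj (tens p q)^T = tens q p.
Proof. by apply/matrixP => i j; rewrite !mxE rmorphM /= conjCK mulrC. Qed.

Record herm := Herm { hmat :> 'M[C]_d.+1; _ : hmat \is hermsymmx }.

HB.instance Definition _ := [isSub for hmat].
HB.instance Definition _ := [Choice of herm by <:].

Lemma hermsymmxP (A : 'M[C]_d.+1) :
  reflect (map_mx Num.conj A^T = A) (A \is hermsymmx).
Proof.
by rewrite is_hermitianmxE expr0 scale1r eq_sym; apply: eqP.
Qed.

Fact hermsymmx_zmod : zmod_closed (mem (hermsymmx : qualifier 0 'M[C]_d.+1)).
Proof.
split=> [|A B /hermsymmxP hA /hermsymmxP hB]; apply/hermsymmxP.
  by rewrite trmx0 map_mx0.
by rewrite linearB map_mxB hA hB.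
Qed.
HB.instance Definition _ := GRing.isZmodClosed.Build 'M[C]_d.+1
  (hermitianmx d.+1 false Num.conj : {pred 'M[C]_d.+1}) hermsymmx_zmod.
HB.instance Definition _ := [SubChoice_isSubZmodule of herm by <:].

Fact hscale_subproof (t : R) (A : herm) :
  (t%:C)%C *: (A : 'M[C]_d.+1) \is hermsymmx.
Proof.
case: A => A /= /hermsymmxP hA; apply/hermsymmxP.
by rewrite linearZ map_mxZ hA; congr (_ *: _); apply: conjc_real.
Qed.
Definition hscale t A : herm := Herm (hscale_subproof t A).

Fact hscaleA a b A : hscale a (hscale b A) = hscale (a * b) A.
Proof. by apply/val_inj; rewrite /= scalerA -rmorphM. Qed.
Fact hscale1 : left_id 1 hscale.
Proof. by move=> A; apply/val_inj; rewrite /= rmorph1 scale1r. Qed.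
Fact hscaleDr : right_distributive hscale +%R.
Proof. by move=> a A B; apply/val_inj; rewrite /= scalerDr. Qed.
Fact hscaleDl A : {morph hscale^~ A : a b / a + b}.
Proof. by move=> a b; apply/val_inj; rewrite /= rmorphD scalerDl. Qed.
HB.instance Definition _ := GRing.Zmodule_isLmodule.Build R herm
  hscaleA hscale1 hscaleDr hscaleDl.

Fact htens_subproof (p : cform) : tens p p \is hermsymmx.
Proof. exact/hermsymmxP/tens_adjoint. Qed.
Definition htens (p : cform) : herm := Herm (htens_subproof p).

Definition has_rank (theta : herm) (r : nat) : Prop :=
  exists (e : 'I_r -> bool) (p : r.-tuple cform),
    free p /\ theta = \sum_(j < r) (-1 : R) ^+ e j *: htens (tnth p j).

Definition psd (theta : herm) : Prop :=
  exists r (p : r.-tuple cform),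
    free p /\ theta = \sum_(j < r) htens (tnth p j).

Definition hgram (f : {mpoly R[2]}) : set herm :=
  [set theta | psd theta /\ mu theta = map_mpoly (real_complex R) f].

End HermitianTensors.

Arguments hgram {R} d f _.

Definition nonneg_form (R : realType) (f : {mpoly R[2]}) : Prop :=
  forall v : 'I_2 -> R, 0 <= f.@[v].

(* Main.v *)
(** Let [F] be a polyhedral face of dimension [k > 0].  Since the Gram
spectrahedron contains no ray, [F] has [m >= k+1] facets; let [L_i] be the
affine function cutting out the i-th facet, [x0] a relative interior point of
[F] and [y_i] one of the i-th facet.  Some vector [u_i] is in the kernel of [y_i]
but not in that of [x0].  Then [theta u_i] vanishes for [theta] on the i-th facet,
so by affinity [theta u_i = L_i(theta) w_i] on [F], where [w_i = x0 u_i].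
Comparing [u_j^* theta u_i] with its conjugate gives [u_j^* w_i = 0] for [i <> j].
If a Hermitian combination [H] of the [w_i w_j^*], [i <> j], is killed by [mu],
then [x0 + e H] stays in [F] for small [e], hence [u_i^* H u_j = 0] for [i <> j]
and [H = 0].  Thus [mu] is injective on a real space of dimension [m (m - 1)],
with values in the real forms of degree [2d], so [k (k+1) <= 2d + 1].

If a vertex [theta] has rank one, then [theta u_i = L_i(theta) w_i] shows that
[theta] is a multiple of [w_i w_i^*] for the only [i] with [L_i(theta) <> 0], the
multiple being fixed by [mu theta = f].  As the [w_i w_i^*] are linearly
independent, the vertices are affinely independent. *)

Require Import Defs.
From HB Require Import structures.
From mathcomp Require Import all_boot all_order all_algebra.
From mathcomp Require Import boolp classical_sets reals convex.
From mathcomp Require Import complex mpoly.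
From mathcomp Require Import ring lra zify.

Set Implicit Arguments.
Unset Strict Implicit.
Unset Printing Implicit Defensive.

Import Order.TTheory GRing.Theory Num.Theory.

Local Open Scope classical_set_scope.
Local Open Scope ring_scope.

(** * Polyhedra *)

Lemma small_step (R : realFieldType) n (a b : 'I_n -> R) :
  (forall i, 0 < b i) ->
  exists2 e : R, 0 < e & forall i, e * a i <= b i.
Proof.
move=> b_gt0.
(* One step serves all indices: every ratio is at most [S], and the added 1 keeps the denominator
   positive when [S] is zero. *)
pose S := \sum_i `|a i| / b i.
have S_ge0 : 0 <= S.
  by apply: sumr_ge0 => i _; rewrite divr_ge0 // ltW.
have S1_gt0 : 0 < 1 + S by lra.
exists (1 + S)^-1 => [|i]; first by rewrite invr_gt0.
rewrite mulrC ler_pdivrMr // mulrC -ler_pdivrMr //.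
have : `|a i| / b i <= S.
  rewrite /S (bigD1 i) //= lerDl; apply: sumr_ge0 => j _.
  by rewrite divr_ge0 // ltW.
have : a i / b i <= `|a i| / b i.
  by rewrite ler_pM2r ?invr_gt0 // ler_norm.
lra.
Qed.

Section Polyhedra.
Variables (R : realType) (E : lmodType R).
Implicit Types (A F : set E).

Lemma sub_aff_hull A x : A x -> aff_hull A x.
Proof.
move=> Ax; exists 1%N, (fun=> x), (fun=> 1).
by split=> //; rewrite big_ord1 ?scale1r.
Qed.

(** Algebraic substitute for boundedness, requiring no topology on [E]. *)
Definition ray_free F :=
  forall x v, (forall t : R, 0 <= t -> F (x + t *: v)) -> v = 0.

Section Frame.
Variables (k : nat) (v : 'I_k.+1 -> E).

Definition frame_dir (c : 'rV[R]_k) : E :=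
  \sum_j c 0 j *: (v (lift ord0 j) - v ord0).

Fact frame_dir_is_linear : linear frame_dir.
Proof.
move=> a c e; rewrite /frame_dir scaler_sumr -big_split /=.
by apply: eq_bigr => j _; rewrite !mxE scalerDl scalerA.
Qed.
HB.instance Definition _ :=
  GRing.isLinear.Build R 'rV[R]_k E _ frame_dir frame_dir_is_linear.

Lemma frame_dir_inj c : aff_indep v -> frame_dir c = 0 -> c = 0.
Proof.
move=> vi c0; apply/rowP => j; rewrite mxE.
(* Giving [v ord0] the opposite of the other coefficients turns a relation among the differences
   into an affine relation among the points. *)
pose a (i : 'I_k.+1) := if unlift ord0 i is Some l then c 0 l
  else - \sum_l c 0 l.
have a0 : a ord0 = - \sum_l c 0 l by rewrite /a unlift_none.
have aS l : a (lift ord0 l) = c 0 l by rewrite /a liftK.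
rewrite -aS; apply: (vi a); rewrite big_ord_recl a0.
  by under [X in _ + X]eq_bigr do rewrite aS; rewrite addNr.
rewrite -[RHS]c0 /frame_dir; under [X in _ + X]eq_bigr do rewrite aS.
under [RHS]eq_bigr do rewrite scalerBr.
by rewrite sumrB scaleNr -scaler_suml addrC.
Qed.

Lemma aff_hull_frame x :
  aff_hull (range v) x -> exists c, x = v ord0 + frame_dir c.
Proof.
move=> [n [w [a [rw a1 ->]]]].
have dir i : exists c, w i = v ord0 + frame_dir c.
  have [j _ <-] := rw i; case: (unliftP ord0 j) => [l ->|->].
    exists (delta_mx 0 l); rewrite /frame_dir (bigD1 l) //= big1 => [|l' ll'].
      by rewrite !mxE !eqxx scale1r addr0 subrKC.
    by rewrite !mxE eqxx (negbTE ll') scale0r.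
  by exists 0; rewrite linear0 addr0.
have {}[g gE] := choice dir.
exists (\sum_i a i *: g i); rewrite linear_sum /=.
under eq_bigr do rewrite gE scalerDr.
rewrite big_split /= -scaler_suml a1 scale1r; congr (_ + _).
by apply: eq_bigr => i _; rewrite linearZ.
Qed.
End Frame.

(** The form in which dimension is used later: [V] parametrizes the directions of [F], and the third
    clause prevents its image from being too large. *)
Lemma dim_frame F k : has_dim F k ->
  exists V : {linear 'rV[R]_k -> E},
  [/\ forall c, V c = 0 -> c = 0,
      forall x y, F x -> F y -> exists c, y = x + V c
    & forall (g : {scalar E}) a, (forall x, F x -> g x = a) ->
        forall c, g (V c) = 0].
Proof.
move=> [v [vi vF]]; exists (frame_dir v); split.
- by move=> c; apply: frame_dir_inj.
- move=> x y /sub_aff_hull Fx /sub_aff_hull Fy; rewrite vF in Fx Fy.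
  have [c ->] := aff_hull_frame Fx; have [e ->] := aff_hull_frame Fy.
  by by exists (e - c); rewrite linearB -addrA subrKC.
- move=> g a ga c.
  have gv i : g (v i) = a.
    have : aff_hull F (v i) by rewrite vF; apply: sub_aff_hull; exists i.
    move=> [n [w [b [Fw b1 ->]]]]; rewrite linear_sum /=.
    under eq_bigr do rewrite linearZ /= ga //.
    by rewrite -mulr_suml b1 mul1r.
  rewrite /frame_dir linear_sum big1 // => j _.
  by rewrite linearZ linearB /= !gv subrr mulr0.
Qed.

Lemma dim0_singleton F x : has_dim F 0 -> F x -> F = [set x].
Proof.
move=> /dim_frame[V [_ FV _]] Fx; apply/seteqP; split=> [y Fy|_ -> //] /=.
have [c ->] := FV _ _ Fx Fy.
by rewrite thinmx0 linear0 addr0.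
Qed.

Lemma conv_hullW A B : A `<=` B -> conv_hull A `<=` conv_hull B.
Proof.
by move=> AB _ [n [w [a [Aw a0 a1 ->]]]]; exists n, w, a; split=> // i; apply: AB.
Qed.

Lemma sub_conv_hull A x : A x -> conv_hull A x.
Proof.
move=> Ax; exists 1%N, (fun=> x), (fun=> 1); split=> //.
- by rewrite big_ord1.
- by rewrite big_ord1 scale1r.
Qed.

Lemma conv_hull_segment A x y (t : R) : 0 <= t <= 1 ->
  conv_hull A x -> conv_hull A y -> conv_hull A ((1 - t) *: x + t *: y).
Proof.
move=> /andP[t0 t1] [n [w [a [Aw a0 a1 ->]]]] [m [z [b [Az b0 b1 ->]]]].
exists (n + m)%N.
exists (fun i => match split i with inl j => w j | inr j => z j end).
exists (fun i => match split i with inl j => (1 - t) * a j | inr j => t * b j end).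
split.
- by move=> i; case: splitP.
- by move=> i; case: splitP => j _; rewrite mulr_ge0 // subr_ge0.
- rewrite big_split_ord /=.
  under eq_bigr do rewrite (unsplitK (inl _)).
  under [X in _ + X]eq_bigr do rewrite (unsplitK (inr _)).
  by rewrite -!mulr_sumr a1 b1 !mulr1 subrK.
rewrite big_split_ord /= !scaler_sumr; congr (_ + _); apply: eq_bigr => i _.
  by rewrite (unsplitK (inl _)) scalerA.
by rewrite (unsplitK (inr _)) scalerA.
Qed.

(** * Minkowski's theorem for polyhedra without rays *)

Section Inequalities.
Variables (n : nat) (l : 'I_n -> {scalar E}) (b : 'I_n -> R).
Local Notation P := [set x : E | forall i, l i x <= b i].
Hypothesis P_rf : ray_free P.

(** Ratio test: without rays some constraint increases along [v], and the one with the smallest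
    ratio of slack to slope becomes tight first. *)
Lemma exit_point x v : P x -> v <> 0 ->
  (forall i, l i x = b i -> l i v = 0) ->
  exists t : R, [/\ 0 <= t, P (x + t *: v) &
    exists2 i, l i x < b i & l i (x + t *: v) = b i].
Proof.
move=> Px v0 act.
have [i0 i0v] : exists i, 0 < l i v.
  apply/not_existsP => nv; apply: v0; apply: (P_rf (x := x)) => t t0 i.
  rewrite linearD linearZ /=.
  have := Px i; have /negP := nv i; rewrite -leNgt => lv.
  have := mulr_ge0_le0 t0 lv; lra.
pose r i := (b i - l i x) / l i v.
have [i iv imin] := arg_minP r (P := fun i => 0 < l i v) i0v.
have ix : l i x < b i.
  rewrite lt_neqAle Px andbT; apply/eqP => /act e.
  by rewrite e ltxx in iv.
have tl : r i * l i v = b i - l i x by rewrite /r mulfVK // gt_eqF.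
have r0 : 0 <= r i by rewrite divr_ge0 ?ltW // subr_gt0.
exists (r i); split=> //; last first.
  by exists i => //; rewrite linearD linearZ /= tl; lra.
move=> j; rewrite linearD linearZ /=.
have [jv|jv] := ltP 0 (l j v).
  have := imin j jv; rewrite {2}/r ler_pdivlMr //; lra.
have := Px j; have := mulr_ge0_le0 r0 jv; lra.
Qed.

(** Induction on the number of slack constraints: a non-extreme point is inside a segment of [P];
    followed both ways, that line reaches two points with fewer slack constraints. *)
Lemma ray_free_polyhedron_conv_extreme : P `<=` conv_hull (extreme_points P).
Proof.
move=> x Px.
have [m] := ubnP #|[pred i | l i x < b i]|.
elim: m x Px => // m IH x Px; rewrite ltnS => xm.
have [ex|nex] := pselect (extreme_points P x); first exact: sub_conv_hull.
have [y [z [t [[Py Pz t0 t1 xE] yz]]]] : exists y z (t : R),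
    [/\ P y, P z, 0 < t, t < 1 & x = (1 - t) *: y + t *: z] /\ y <> z.
  apply: contra_notP nex => nex; split=> // y z t Py Pz t0 t1 xE.
  have yz : y = z.
    by apply: contrapT => yz; apply: nex; exists y, z, t.
  by rewrite xE -yz -scalerDl subrK scale1r.
pose v := z - y.
have v0 : v <> 0 by move=> /subr0_eq /esym.
(* A constraint tight inside the segment is tight at both ends, hence constant along [v]. *)
have act i : l i x = b i -> l i v = 0.
  rewrite xE linearD !linearZ linearB /=; have := Py i; have := Pz i.
  move=> hz hy e.
  have hz' : 0 <= t * (b i - l i z) by apply: mulr_ge0; lra.
  have hy' : 0 <= (1 - t) * (b i - l i y) by apply: mulr_ge0; lra.
  have /eqP : t * (b i - l i z) = 0 by lra.
  have /eqP : (1 - t) * (b i - l i y) = 0 by lra.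
  rewrite !mulf_eq0 => /orP[/eqP|/eqP] + /orP[/eqP|/eqP]; lra.
clear yz; clearbody v.
have step w : w <> 0 -> (forall i, l i x = b i -> l i w = 0) ->
    exists t : R, [/\ 0 <= t, x + t *: w != x & conv_hull (extreme_points P) (x + t *: w)].
  move=> w0 actw; have [s [s0 Ps [i ix iE]]] := exit_point Px w0 actw.
  exists s; split=> //; first by apply: contraTneq ix => e; rewrite -iE e ltxx.
  apply: IH => //; apply: leq_trans xm; apply: proper_card; apply/properP; split.
    apply/fintype.subsetP => j; rewrite !inE => sj; rewrite lt_neqAle Px andbT.
    apply: contraTneq sj => jE; rewrite linearD linearZ /= actw // mulr0 addr0.
    by rewrite jE ltxx.
  by exists i; rewrite !inE ?iE ?ltxx.
have [s [s0 sx Cs]] := step v v0 act.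
have [|j jE|r [r0 rx Cr]] := step (- v).
- by move=> /eqP; rewrite oppr_eq0 => /eqP.
- by rewrite linearN /= act // oppr0.
have sp : 0 < s.
  by rewrite lt_neqAle s0 andbT eq_sym; apply: contraNneq sx => ->; rewrite scale0r addr0.
have rp : 0 < r.
  by rewrite lt_neqAle r0 andbT eq_sym; apply: contraNneq rx => ->; rewrite scale0r addr0.
have rs0 : r + s != 0 by rewrite gt_eqF // addr_gt0.
(* The weight for which the two opposite displacements cancel. *)
pose q := r / (r + s).
have -> : x = (1 - q) *: (x + r *: - v) + q *: (x + s *: v).
  have e : (1 - q) * r = q * s by rewrite /q; field.
  rewrite !scalerDr addrACA -scalerDl subrK scale1r !scalerA e scalerN.
  by rewrite addNr addr0.
apply: conv_hull_segment => //.
by rewrite divr_ge0 ?addr_ge0 //= ler_pdivrMr ?addr_gt0 // mul1r lerDl.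
Qed.
End Inequalities.

End Polyhedra.

(** If [A] is not row free, a kernel vector works; otherwise [A] is square and invertible, and
    [c *m A] can be made constantly -1. This will force more than [k] facets. *)
Lemma exists_nonpos_mulmx (R : realFieldType) k m (A : 'M[R]_(k, m)) :
  (0 < k)%N -> (m <= k)%N ->
  exists2 c : 'rV_k, c != 0 & forall i, (c *m A) 0 i <= 0.
Proof.
move=> k_gt0 mk; have [fA|nfA] := boolP (row_free A); last first.
  rewrite -kermx_eq0 in nfA; have /rowV0Pn[c /sub_kermxP cA c0] := nfA.
  by exists c => // i; rewrite cA mxE.
have rA : \rank A = k by apply/eqP.
have mE : m = k by apply/eqP; rewrite eqn_leq mk -[X in (X <= _)%N]rA rank_leq_col.
have fullA : row_full A by rewrite /row_full rA mE.
have /submxP[c cE] : ((const_mx (-1) : 'rV_m) <= A)%MS by apply: submx_full.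
exists c => [|i]; last by rewrite -cE mxE lerN10.
apply: contra_eq_neq cE => ->; rewrite mul0mx; apply/eqP => /rowP.
have i0 : 'I_m by rewrite mE; exact: Ordinal k_gt0.
by move=> /(_ i0)/eqP; rewrite !mxE oppr_eq0 oner_eq0.
Qed.

(* [x0] is a relative interior point of [F], [y i] one of its i-th facet, and
   [L i] is the affine function vanishing on that facet, normalized by
   [L i x0 = 1]; the vector [v] below is then parallel to the facet. *)
Record facet_system (R : realType) (E : lmodType R) (F : set E) (x0 : E)
    (m : nat) (L : 'I_m -> E -> R) (y : 'I_m -> E) : Prop := FacetSystem {
  facet_base : F x0;
  facet_point : forall i, F (y i);
  facet_point_neq0 : forall i j, i != j -> L j (y i) != 0;
  facet_exit : forall i e, 0 < e -> ~ F (y i + e *: (y i - x0));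
  facet_span : forall i x, F x ->
    let v := x - x0 - (1 - L i x) *: (y i - x0) in
    exists2 e, 0 < e & F (y i + e *: v) /\ F (y i - e *: v);
  facet_cap : forall x, F x -> exists i, L i x != 0
}.

(** * Facets of a polyhedron without rays *)

Section Facets.
Variables (R : realType) (E : lmodType R).
Variables (n : nat) (l : 'I_n -> {scalar E}) (b : 'I_n -> R).
Local Notation P := [set x : E | forall i, l i x <= b i].

(** Averaging [p] with one witness of strictness per constraint gives a point strict wherever some
    witness is; a constraint without witness is tight on all of [P], so it vanishes on [V]. *)
Lemma strict_point (V : E -> Prop) p : P p ->
  (forall i, (forall x, P x -> l i x = b i) -> forall v, V v -> l i v = 0) ->
  exists2 x0, P x0 & forall i v, V v -> l i v != 0 -> l i x0 < b i.
Proof.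
move=> Pp lV.
have /choice[g gP] i :
    exists x, P x /\ ((exists2 v, V v & l i v != 0) -> l i x < b i).
  have [[x [Px xi]]|nx] := pselect (exists x, P x /\ l i x < b i).
    by exists x.
  exists p; split=> // -[v Vv /eqP[]]; apply: lV v Vv => x Px.
  apply/eqP; rewrite eq_le Px leNgt; apply/negP => xi.
  by apply: nx; exists x.
have n1 : 0 < n.+1%:R :> R by rewrite ltr0n.
pose x0 := (n.+1%:R)^-1 *: (p + \sum_i g i).
have lx0 i : l i x0 = (n.+1%:R)^-1 * (l i p + \sum_j l i (g j)).
  by rewrite /x0 linearZ linearD linear_sum.
have bE i : n.+1%:R * b i = b i + \sum_(j < n) b i.
  by rewrite sumr_const card_ord -mulrS mulr_natl.
have le_g i j : l i (g j) <= b i by case: (gP j).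
exists x0 => [i|i v Vv lv].
  by rewrite lx0 mulrC ler_pdivrMr // mulrC bE lerD // ler_sum.
rewrite lx0 mulrC ltr_pdivrMr // mulrC bE ler_ltD //.
rewrite (bigD1 i) //= [ltRHS](bigD1 i) //= ltr_leD //; last exact: ler_sum.
by have [_] := gP i; apply; exists v.
Qed.

Hypothesis P_rf : ray_free P.

Lemma exists_facet_system k p : (0 < k)%N -> has_dim P k -> P p ->
  exists m x0 (L : 'I_m -> E -> R) y, (k < m)%N /\ facet_system P x0 L y.
Proof.
move=> k_gt0 /dim_frame[V [V_inj PV lV]] Pp.
have [|x0 Px0 lx0] := @strict_point (range V) p Pp.
  by move=> i lb _ [c _ <-]; apply: lV lb c.
(* [Q S] says that the constraints in [S] cut out [P] within its affine hull. A minimal such [S] is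
   an irredundant description, one constraint per facet. *)
pose Q (S : {set 'I_n}) := `[< forall c : 'rV_k,
  (forall i, i \in S -> l i (x0 + V c) <= b i) -> P (x0 + V c) >].
(* Starting from the constraints that vary on the affine hull makes every constraint of [S] strict
   at [x0]. *)
pose I0 := [set i : 'I_n | `[< exists c, l i (V c) != 0 >]]%SET.
have QI0 : Q I0.
  apply/asboolP => c h i; have [iI|] := boolP (i \in I0); first exact: h.
  rewrite inE => /asboolPn/forallNP/(_ c)/negP; rewrite negbK linearD => /eqP->.
  by rewrite addr0; apply: Px0.
have [S /minsetP[/asboolP QS Smin] /fintype.subsetP SI] := minset_exists QI0.
have sl_gt0 i : i \in S -> 0 < b i - l i x0.
  move=> /SI; rewrite inE => /asboolP[c ci]; rewrite subr_gt0.
  by apply: lx0 ci; exists c.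
(* By minimality, dropping [i] admits a new point [x0 + V c], which violates constraint [i] and no
   other one of [S]. *)
have /choice[c cP] i : exists c, i \in S ->
    (forall j, j \in S -> j != i -> l j (V c) <= b j - l j x0)
    /\ b i - l i x0 < l i (V c).
  have [iS|] := boolP (i \in S); last by exists 0.
  have /asboolPn/existsNP[c /not_implyP[cS nP]] : ~~ Q (S :\ i)%SET.
    apply/negP => QSi; have := Smin _ QSi (subD1set S i) => /setP/(_ i).
    by rewrite !inE eqxx iS.
  have cS' j : j \in S -> j != i -> l j (V c) <= b j - l j x0.
    by move=> jS ji; have := cS j; rewrite !inE jS ji linearD => /(_ isT); lra.
  exists c => _; split=> //; rewrite ltNge; apply/negP => ci; apply: nP.
  apply: QS => j jS; rewrite linearD /=.
  have [->|ji] := eqVneq j i; first lra.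
  by have := cS' j jS ji; lra.
pose s (i : 'I_#|S|) := enum_val i.
have sS i : s i \in S by apply: enum_valP.
have s_surj i : i \in S -> exists j, s j = i.
  by move=> iS; exists (enum_rank_in iS i); apply: enum_rankK_in.
pose sl i := b (s i) - l (s i) x0.
(* The time at which the segment from [x0] to the violating point crosses hyperplane [s i]; as it is
   below 1, the other constraints of [S] are strict there. *)
pose tau i := sl i / l (s i) (V (c (s i))).
have lc_gt i : sl i < l (s i) (V (c (s i))) by have [] := cP _ (sS i).
have sl0 i : 0 < sl i by apply: sl_gt0.
have lc0 i : 0 < l (s i) (V (c (s i))) := lt_trans (sl0 i) (lc_gt i).
have tau0 i : 0 < tau i by rewrite divr_gt0.
have tau1 i : tau i < 1 by rewrite ltr_pdivrMr // mul1r.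
have tauE i : tau i * l (s i) (V (c (s i))) = sl i by rewrite mulfVK ?gt_eqF.
pose y i := x0 + V (tau i *: c (s i)).
pose L i x := (b (s i) - l (s i) x) / sl i.
have lyi i : l (s i) (y i) = b (s i).
  by rewrite /y linearD linearZ /= linearZ /= tauE /sl; lra.
have lyj i j : j \in S -> j != s i -> l j (y i) < b j.
  move=> jS ji; rewrite /y linearD linearZ /= linearZ /=.
  have [/(_ j jS ji) h _] := cP _ (sS i); have hj := sl_gt0 j jS.
  have : tau i * l j (V (c (s i))) <= tau i * (b j - l j x0) by rewrite ler_pM2l.
  have : tau i * (b j - l j x0) < 1 * (b j - l j x0) by rewrite ltr_pM2r.
  lra.
have Py i : P (y i).
  apply: QS => j jS; have [->|ji] := eqVneq j (s i); first by rewrite lyi.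
  exact/ltW/lyj.
(* With at most [k] constraints, some nonzero direction would increase none of them, and [P] would
   contain a ray. *)
have km : (k < #|S|)%N.
  rewrite ltnNge; apply/negP => mk.
  pose A := \matrix_(j < k, i < #|S|) l (s i) (V (delta_mx 0 j)).
  have [a a0 aA] := exists_nonpos_mulmx A k_gt0 mk.
  have lA i : l (s i) (V a) = (a *m A) 0 i.
    rewrite mxE [in LHS](row_sum_delta a) !linear_sum; apply: eq_bigr => j _.
    by rewrite !linearZ /= mxE.
  have /V_inj/eqP : V a = 0; last by rewrite (negbTE a0).
  apply: (P_rf (x := x0)) => t t0; rewrite -linearZ; apply: QS => j /s_surj[i <-].
  rewrite linearD linearZ /= linearZ /= lA.
  have := mulr_ge0_le0 t0 (aA i); have := Px0 (s i); lra.
exists #|S|, x0, L, y; split=> //; split=> //.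
- move=> i j ij; rewrite mulf_neq0 ?invr_neq0 ?gt_eqF // subr_gt0; apply: lyj => //.
  by rewrite (inj_eq enum_val_inj) eq_sym.
- move=> i e e0 /(_ (s i)); rewrite linearD linearZ linearB /= lyi.
  have := mulr_gt0 e0 (sl0 i); rewrite /sl; lra.
- move=> i x Px v.
  have [c' xE] := PV _ _ Px0 Px.
  pose g := c' - ((1 - L i x) * tau i) *: c (s i).
  have vE : v = V g.
    have xx0 : x - x0 = V c' by rewrite xE addrAC subrr add0r.
    have yx0 : y i - x0 = V (tau i *: c (s i)) by rewrite /y addrAC subrr add0r.
    by rewrite /v xx0 yx0 /g linearB !linearZ /= scalerA.
  have lv : l (s i) v = 0 :> R.
    have LE : L i x * sl i = b (s i) - l (s i) x by rewrite mulfVK ?gt_eqF.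
    rewrite /v linearB linearZ /= !linearB /= lyi -/(sl i) mulrBl mul1r LE.
    by rewrite /sl; lra.
  (* Only the other constraints of [S] limit the step, by their slack at [y i]; the remaining
     indices get the dummy bound 1. *)
  pose bd j := if (j \in S) && (j != s i) then b j - l j (y i) else 1.
  have bd0 j : 0 < bd j.
    by rewrite /bd; case: ifP => // /andP[jS ji]; rewrite subr_gt0 lyj.
  have [e e0 eP] := small_step (fun j => `|l j v|) bd0.
  have st (a : R) : `|a| = e -> P (y i + a *: v).
    move=> ae; have yE : y i + a *: v = x0 + V (tau i *: c (s i) + a *: g).
      by rewrite [in RHS]linearD /= [V (a *: g)]linearZ -vE addrA.
    rewrite yE; apply: QS => j jS; rewrite -yE.
    have [->|ji] := eqVneq j (s i); first by rewrite linearD linearZ /= lv lyi mulr0 addr0.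
    rewrite linearD linearZ /=; have := eP j; rewrite /bd jS ji /= -ae -normrM.
    have := ler_norm (a * l j v); lra.
  by exists e => //; rewrite -scaleNr; split; apply: st; rewrite ?normrN gtr0_norm.
- move=> x Px; apply/not_existsP => L0.
  have lx i : l (s i) x = b (s i).
    have /negP := L0 i; rewrite negbK mulf_eq0 invr_eq0 (gt_eqF (sl0 i)) orbF subr_eq0.
    by move=> /eqP.
  have [a xE] := PV _ _ Px0 Px.
  have la i : l (s i) (V a) = sl i by rewrite /sl -lx xE linearD /=; lra.
  (* If all facet constraints were tight at [x], the direction from [x] to [x0] would decrease all
     of them and span a ray. *)
  have : - V a = 0.
    apply: (P_rf (x := x0)) => t t0; rewrite -linearN -linearZ; apply: QS => j /s_surj[i <-].
    rewrite linearD 2!linearZ /= 2!linearN /= la.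
    have := mulr_ge0 t0 (ltW (sl0 i)); have := Px0 (s i); lra.
  move=> /eqP; rewrite oppr_eq0 => /eqP Va0.
  have i0 : 'I_#|S| by exact: Ordinal (leq_ltn_trans (leq0n k) km).
  by have := sl0 i0; rewrite -la Va0 linear0 ltxx.
Qed.
End Facets.

(** * Moving inside faces, and criteria for simplices *)

Section ConvexHelpers.
Variables (R : realType) (E : lmodType R).
Implicit Types (A F K : set E).

(** The point [y] lies strictly between [x] and the new endpoint, at parameter [(1 + e)^-1]. *)
Lemma face_extend K F x y (e : R) : is_face K F -> 0 < e ->
  K x -> K (y + e *: (y - x)) -> F y -> F (y + e *: (y - x)).
Proof.
move=> [FK _ face] e0 Kx Kz Fy.
have e1 : 0 < 1 + e by lra.
have [] // := face x (y + e *: (y - x)) (1 + e)^-1; rewrite ?invr_gt0 ?invf_lt1 //.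
  lra.
rewrite [X in F X](_ : _ = y) // scalerDr scalerA scalerBr addrCA addrA.
have -> : (1 + e)^-1 * e = 1 - (1 + e)^-1 by field; rewrite gt_eqF.
by rewrite addrACA subrr addr0 -scalerDl subrKC scale1r.
Qed.

Lemma face_midpoint K F x v : is_face K F -> F x -> K (x + v) -> K (x - v) -> F (x + v).
Proof.
move=> Fface Fx Kp Km; have vE : x - (x - v) = v by rewrite opprB subrKC.
have := @face_extend K F (x - v) x 1 Fface ltr01 Km.
by rewrite vE scale1r; apply.
Qed.

Lemma ray_freeS F K : F `<=` K -> ray_free K -> ray_free F.
Proof. by move=> FK Krf x v Fv; apply: (Krf x) => t /Fv/FK. Qed.

(** Nonemptiness of [A] rules out [n = 0], which the indexing in [is_simplex] excludes. *)
Lemma is_simplex_ord A n (v : 'I_n -> E) :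
  A !=set0 -> aff_indep v -> A = conv_hull (range v) -> is_simplex A.
Proof.
case: n v => [|n] v [x Ax] vi AE; last by exists n, v.
move: Ax; rewrite AE => -[n [w [c [rw _ c1 _]]]].
suff : \sum_i c i = 0 by rewrite c1 => /eqP; rewrite oner_eq0.
by apply: big1 => i _; have [[]] := rw i.
Qed.

Lemma polyhedron_conv_hull F : polyhedron F -> conv_hull F `<=` F.
Proof.
move=> [n [l [b ->]]] _ [m [w [c [Pw c0 c1 ->]]]] i.
rewrite linear_sum -[leRHS]mul1r -c1 mulr_suml; apply: ler_sum => j _.
by rewrite linearZ /= ler_wpM2l //; apply: Pw.
Qed.

Lemma set1_is_simplex (x : E) : is_simplex [set x].
Proof.
apply: (@is_simplex_ord _ 1 (fun=> x)); first by exists x.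
  by move=> c; rewrite big_ord1 => c0 _ i; rewrite ord1.
apply/seteqP; split=> [_ ->|_ [n [w [c [rw _ c1 ->]]]]].
  by apply: sub_conv_hull; exists ord0.
rewrite /= -[RHS]scale1r -c1 scaler_suml; apply: eq_bigr => i _.
by have [_ _ <-] := rw i.
Qed.
End ConvexHelpers.

(** * Positive semidefinite matrices *)

Section PositiveMatrices.
Variable C : numClosedFieldType.
Local Notation "A ^H" := (map_mx Num.conj A^T) (at level 8, format "A ^H").

Lemma adjmxK m n (A : 'M[C]_(m, n)) : A^H^H = A.
Proof. by apply/matrixP => i j; rewrite !mxE conjCK. Qed.

Lemma adjmxM m n p (A : 'M[C]_(m, n)) (B : 'M_(n, p)) :
  (A *m B)^H = B^H *m A^H.
Proof. by rewrite trmx_mul map_mxM. Qed.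

Lemma adjmxZ m n a (A : 'M[C]_(m, n)) : (a *: A)^H = a^* *: A^H.
Proof. by rewrite linearZ map_mxZ. Qed.

Definition sesq n (A : 'M[C]_n) (u v : 'cV[C]_n) : C := (u^H *m A *m v) 0 0.

Definition posmx n (A : 'M[C]_n) := forall z, 0 <= sesq A z z.

Section Sesq.
Variables (n : nat) (A : 'M[C]_n).
Implicit Types u v w : 'cV[C]_n.

Lemma sesqDl u v w : sesq A (u + v) w = sesq A u w + sesq A v w.
Proof. by rewrite /sesq linearD map_mxD !mulmxDl mxE. Qed.

Lemma sesqDr u v w : sesq A u (v + w) = sesq A u v + sesq A u w.
Proof. by rewrite /sesq mulmxDr mxE. Qed.

Lemma sesqZl a u v : sesq A (a *: u) v = a^* * sesq A u v.
Proof. by rewrite /sesq linearZ map_mxZ -!scalemxAl mxE. Qed.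

Lemma sesqZr a u v : sesq A u (a *: v) = a * sesq A u v.
Proof. by rewrite /sesq -scalemxAr mxE. Qed.

Lemma sesq_delta i v : sesq A (delta_mx i 0) v = (A *m v) i 0.
Proof.
rewrite /sesq -mulmxA mxE (bigD1 i) //= big1 => [|j ji].
  by rewrite !mxE !eqxx rmorph1 mul1r addr0.
by rewrite !mxE (negbTE ji) rmorph0 mul0r.
Qed.

End Sesq.

Lemma sesq_conj n (A : 'M[C]_n) u v : A^H = A -> (sesq A u v)^* = sesq A v u.
Proof.
move=> hA; rewrite /sesq.
have <- : (u^H *m A *m v)^H = v^H *m A *m u by rewrite !adjmxM adjmxK hA mulmxA.
by rewrite !mxE.
Qed.

Section Positive.
Variables (n : nat) (A : 'M[C]_n).
Hypotheses (hA : A^H = A) (pA : posmx A).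

Lemma posmx_Cauchy_Schwarz u v :
  `|sesq A u v| ^+ 2 <= sesq A u u * sesq A v v.
Proof.
set a := sesq A u u; set c := sesq A v v; set b := sesq A u v.
have a0 : 0 <= a := pA u; have c0 : 0 <= c := pA v.
have aC : a^* = a := geC0_conj a0.
have vu : sesq A v u = b^* by rewrite sesq_conj.
rewrite normCK.
have [a_gt0|] := boolP (0 < a); last first.
  rewrite lt0r a0 andbT negbK => /eqP aE; rewrite aE mul0r.
  have [->|b0] := eqVneq b 0; first by rewrite mul0r.
  have bb : 0 < b * b^* by rewrite mul_conjC_gt0.
  (* When [a = 0], the form at [v - t b u] is [c - 2 t |b|^2]; this [t] makes it [-(c + 2)], which
     is negative. *)
  have [t t0 tE] : exists2 t, 0 <= t & t * (b * b^*) = c + 1.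
    exists ((c + 1) / (b * b^*)); last by rewrite mulfVK // gt_eqF.
    by rewrite divr_ge0 ?addr_ge0 // ltW.
  have := pA (v + (- t * b) *: u).
  rewrite sesqDl !sesqDr !sesqZl !sesqZr -/a -/b -/c aE vu !mulr0 addr0.
  rewrite rmorphM rmorphN /= (geC0_conj t0) !mulNr -!mulrA [b^* * b]mulrC.
  rewrite tE (_ : c - (c + 1) - (c + 1) = - (c + 1 + 1)); last by ring.
  have c2 : 0 < c + 1 + 1 by rewrite ltr_wpDl // addr_ge0.
  by rewrite oppr_ge0 => /(lt_le_trans c2); rewrite ltxx.
have := pA (a *: v + (- b) *: u).
rewrite sesqDl !sesqDr !sesqZl !sesqZr -/a -/b -/c vu aC.
have -> : a * (a * c) + a * (- b * b^*) + ((- b)^* * (a * b) + (- b)^* * (- b * a)) =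
   a * (a * c - b * b^*) by rewrite rmorphN; ring.
by rewrite pmulr_rge0 // subr_ge0.
Qed.

(** Cauchy-Schwarz against the basis vectors kills each coordinate of [A *m u]. *)
Lemma posmx_null u : sesq A u u = 0 -> A *m u = 0.
Proof.
move=> u0; apply/colP => i; rewrite [RHS]mxE -sesq_delta; apply/eqP.
suff : `|sesq A (delta_mx i 0) u| ^+ 2 == 0 by rewrite expf_eq0 normr_eq0.
rewrite eq_le exprn_ge0 // andbT.
by have := posmx_Cauchy_Schwarz (delta_mx i 0) u; rewrite u0 mulr0.
Qed.

(** With [w = A z], Cauchy-Schwarz bounds each [|w i|^2] by [A i i] times the form of [A] at [z], so
    the form of [A B A] is at most a constant times that of [A]. *)
Lemma posmx_perturb (B : 'M[C]_n) : B^H = B ->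
  exists2 e : C, 0 < e &
    posmx (A + e *: (A *m B *m A)) /\ posmx (A - e *: (A *m B *m A)).
Proof.
move=> hB.
pose D i := A i i.
have DE i : D i = sesq A (delta_mx i 0) (delta_mx i 0).
  by rewrite sesq_delta -colE mxE.
have D0 i : 0 <= D i by rewrite DE.
pose M := 1 + \sum_i \sum_j `|B i j| * (D i + D j).
have M0 : 0 < M.
  rewrite ltr_pwDl // sumr_ge0 // => i _; apply: sumr_ge0 => j _.
  by rewrite mulr_ge0 ?addr_ge0.
have bound z : `|sesq (A *m B *m A) z z| <= M * sesq A z z.
  set q := sesq A z z; have q0 : 0 <= q := pA z.
  pose w := A *m z.
  have w2 i : `|w i 0| ^+ 2 <= D i * q.
    by rewrite /w -sesq_delta DE posmx_Cauchy_Schwarz.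
  have -> : sesq (A *m B *m A) z z = \sum_i \sum_j (w i 0)^* * B i j * w j 0.
    rewrite /sesq !mulmxA -[in LHS]hA -adjmxM hA -mulmxA mxE exchange_big.
    apply: eq_bigr => j _; rewrite mxE mulr_suml; apply: eq_bigr => i _.
    by rewrite !mxE.
  apply: le_trans (_ : \sum_i \sum_j `|B i j| * (D i + D j) * q <= _).
    apply: le_trans (ler_norm_sum _ _ _) _; apply: ler_sum => i _.
    apply: le_trans (ler_norm_sum _ _ _) _; apply: ler_sum => j _.
    rewrite !normrM norm_conjC -mulrA mulrCA -mulrA ler_wpM2l //.
    rewrite mulrDl; apply: le_trans (lerD (w2 i) (w2 j)).
    have : 0 <= (`|w i 0| - `|w j 0|) ^+ 2 by rewrite real_exprn_even_ge0 // rpredB // normr_real.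
    have : 0 <= `|w i 0| * `|w j 0| by rewrite mulr_ge0.
    move=> h1 h2; rewrite -subr_ge0; have := addr_ge0 h1 h2.
    by congr (_ <= _); ring.
  rewrite /M mulrDl mul1r mulr_suml -[leLHS]add0r lerD //.
  by apply: ler_sum => i _; rewrite mulr_suml.
have realz z : sesq (A *m B *m A) z z \is Num.real.
  by apply/CrealP; rewrite sesq_conj // !adjmxM hA hB mulmxA.
exists M^-1; first by rewrite invr_gt0.
have dist (s : C) z : sesq (A + s *: (A *m B *m A)) z z =
    sesq A z z + s * sesq (A *m B *m A) z z.
  by rewrite /sesq mulmxDr mulmxDl -scalemxAr -scalemxAl mxE [X in _ + X]mxE.
split=> z; rewrite -?scaleNr dist.
  have := bound z; rewrite real_ler_norml // => /andP[h _].
  rewrite -(pmulr_rge0 _ M0) mulrDr mulVKf ?gt_eqF // addrC.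
  by rewrite -[X in _ <= _ + X]opprK subr_ge0.
have := bound z; rewrite real_ler_norml // => /andP[_ h].
rewrite -(pmulr_rge0 _ M0) mulrDr mulNr mulrN mulVKf ?gt_eqF //.
by rewrite subr_ge0.
Qed.

End Positive.

(** Kernel inclusion gives row space inclusion, so [X = X P Y]; the adjoint identity is
    [X = Y P^H X], and [B = P^H X P] works. *)
Lemma adjmx_factor n (X Y : 'M[C]_n) : X^H = X -> Y^H = Y ->
  (forall u : 'cV_n, Y *m u = 0 -> X *m u = 0) ->
  exists2 B : 'M_n, B^H = B & X = Y *m B *m Y.
Proof.
move=> hX hY XY.
have XY_sub : (X <= Y)%MS.
  rewrite submxE; apply/eqP/matrixP => i j.
  have /colP/(_ i) : X *m col j (cokermx Y) = 0.
    by apply: XY; rewrite colE mulmxA mulmx_coker mul0mx.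
  by rewrite colE mulmxA -colE !mxE.
have [P XP] : exists P, X *m P *m Y = X.
  by exists (pinvmx Y); apply: mulmxKpV.
have PX : Y *m P^H *m X = X.
  by have := congr1 (fun M => M^H) XP; rewrite !adjmxM hX hY mulmxA.
exists (P^H *m X *m P).
  by rewrite !adjmxM adjmxK hX mulmxA.
by rewrite !mulmxA PX XP.
Qed.

(** As [T u] is a multiple of [q], its outer square is a multiple of [T]: a rank-one tensor is
    recovered from one nonisotropic vector. *)
Lemma rank1_sesq n (q : 'cV[C]_n) (a : C) (u : 'cV_n) : a^* = a ->
  let T := a *: (q *m q^H) in
  sesq T u u *: T = (T *m u) *m (T *m u)^H.
Proof.
move=> aR T; have hT : T^H = T by rewrite /T adjmxZ adjmxM adjmxK aR.
rewrite adjmxM hT mulmxA /sesq /T.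
set x := u^H *m q; set y := q^H *m u.
have -> : u^H *m (a *: (q *m q^H)) *m u = a *: (x *m y).
  by rewrite -scalemxAr -scalemxAl !mulmxA.
have -> : a *: (q *m q^H) *m u *m u^H *m (a *: (q *m q^H)) =
   (a * a) *: (q *m (y *m x) *m q^H).
  by rewrite -scalemxAr -!scalemxAl scalerA !mulmxA.
rewrite [x]mx11_scalar [y]mx11_scalar -!scalar_mxM mul_mx_scalar -scalemxAl.
by rewrite !mxE !eqxx /= !scalerA; congr (_ *: _); ring.
Qed.

Lemma posmx_outer n (v : 'cV[C]_n) : posmx (v *m v^H).
Proof.
move=> z; rewrite /sesq mulmxA -mulmxA -[z^H *m v]adjmxK adjmxM adjmxK.
by rewrite mxE big_ord1 [X in X * _]mxE mxE mulrC mul_conjC_ge0.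
Qed.

Lemma posmx_sum n I (r : seq I) (Q : pred I) (F : I -> 'M[C]_n) :
  (forall i, Q i -> posmx (F i)) -> posmx (\sum_(i <- r | Q i) F i).
Proof.
move=> pF z; rewrite /sesq mulmx_sumr mulmx_suml summxE.
by apply: sumr_ge0 => i Qi; apply: pF.
Qed.

(** The rows of [P] are eigenvectors scaled by square roots of eigenvalues; keeping only the nonzero
    eigenvalues makes [P] row free. *)
Lemma posmx_spectral n (A : 'M[C]_n) : A^H = A -> posmx A ->
  exists r (P : 'M[C]_(r, n)),
    row_free P /\ A = P^H *m P.
Proof.
move=> hA pA.
have nA : A \is normalmx by apply/normalmxP; rewrite hA.
have AE := orthomx_spectralP nA; set S := spectralmx A in AE; set D := spectral_diag A in AE.
have uS : S \is unitarymx := spectral_unitarymx A.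
rewrite invmx_unitary // in AE.
have SS : S *m S^H = 1%:M by apply/unitarymxP.
have dE : S *m A *m S^H = diag_mx D.
  by rewrite AE !mulmxA SS mul1mx -mulmxA SS mulmx1.
have D0 l : 0 <= D 0 l.
  have := pA (S^H *m delta_mx l 0).
  rewrite [sesq _ _ _](_ : _ = sesq (S *m A *m S^H) (delta_mx l 0) (delta_mx l 0)).
    by rewrite sesq_delta -colE dE !mxE eqxx.
  by rewrite /sesq adjmxM adjmxK !mulmxA.
pose s (i : 'I_#|[pred l | D 0 l != 0]|) := enum_val i.
have sD i : sqrtC (D 0 (s i)) != 0 by rewrite sqrtC_eq0; apply: (enum_valP i).
pose P := \matrix_(i, j) (sqrtC (D 0 (s i)) * S (s i) j).
exists #|[pred l | D 0 l != 0]|, P; split.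
  apply/row_freeP; exists (\matrix_(j, i) ((S (s i) j)^* / sqrtC (D 0 (s i)))).
  apply/matrixP => i i'; have /matrixP/(_ (s i) (s i')) := SS.
  rewrite !mxE (inj_eq enum_val_inj) => SSi.
  transitivity (sqrtC (D 0 (s i)) / sqrtC (D 0 (s i')) * (i == i')%:R).
    rewrite -SSi mulr_sumr; apply: eq_bigr => j _; rewrite !mxE; ring.
  by have [->|] := eqVneq i i'; rewrite ?mulr0 // mulr1 divff.
rewrite [LHS]AE; apply/matrixP => i j; rewrite !mxE.
rewrite (bigID [pred l | D 0 l != 0]) /= [X in _ + X]big1 ?addr0 => [|l]; last first.
  by rewrite negbK mul_mx_diag !mxE => /eqP->; rewrite mulr0 mul0r.
rewrite big_enum_val; apply: eq_bigr => l _; rewrite mul_mx_diag !mxE -/(s l).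
have := sqrtCK (D 0 (s l)).
have : (sqrtC (D 0 (s l)))^* = sqrtC (D 0 (s l)) by apply: geC0_conj; rewrite sqrtC_ge0.
by move=> tR t2; rewrite rmorphM /= tR -[X in _ * X * _ = _]t2; ring.
Qed.
End PositiveMatrices.

(** * Gram tensors as matrices *)

Section HermitianForms.
Variables (R : realType) (d : nat).
Local Notation C := R[i].
Local Notation "A ^H" := (map_mx Num.conj A^T) (at level 8, format "A ^H").

Lemma herm_adj (T : herm R d) : (hmat T)^H = hmat T.
Proof. by case: T => T /= /hermsymmxP. Qed.

Lemma pos_complex (e : C) : 0 < e -> exists2 r : R, 0 < r & e = (r%:C)%C.
Proof.
case: e => r s; rewrite ltcE /= => /andP[/eqP -> r0].
by exists r.
Qed.

Lemma conj_real_complex (r : R) : ((r%:C)%C : C)^* = (r%:C)%C.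
Proof. exact: conjc_real. Qed.

Definition cvec (p : cform R d) : 'cV[C]_d.+1 := \col_i (val p)@_(bmon i).

Lemma tensE (p : cform R d) : tens p p = cvec p *m (cvec p)^H.
Proof. by apply/matrixP => i j; rewrite !mxE big_ord1 !mxE. Qed.

Fact form_of_subproof (v : 'cV[C]_d.+1) :
  \sum_i v i 0 *: 'X_[bmon i] \is d.-homog.
Proof.
apply: rpred_sum => i _; apply: rpredZ; rewrite dhomogX /=.
by rewrite mdegE big_ord_recl big_ord1 !multinomE !(tnth_nth 0%N) /= subnKC ?leq_ord.
Qed.
Definition form_of v : cform R d := DHomog (form_of_subproof v).

Lemma form_ofK : cancel form_of cvec.
Proof.
move=> v; apply/colP => j; rewrite mxE /= raddf_sum (bigD1 j) //= big1 => [|i ij].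
  by rewrite mcoeffZ mcoeffX eqxx mulr1 addr0.
by rewrite mcoeffZ mcoeffX (inj_eq (@bmon_inj d)) (negbTE ij) mulr0.
Qed.

Fact cvec_is_linear : linear cvec.
Proof. by move=> a p q; apply/colP => i; rewrite !mxE mcoeffD mcoeffZ. Qed.
HB.instance Definition _ :=
  GRing.isLinear.Build C (cform R d) 'cV[C]_d.+1 _ cvec cvec_is_linear.

Lemma hmat_sum I (r : seq I) (Q : pred I) (F : I -> herm R d) :
  hmat (\sum_(i <- r | Q i) F i) = \sum_(i <- r | Q i) hmat (F i).
Proof. by elim/big_rec2: _ => // i A B _ <-. Qed.

Lemma psd_posmx (T : herm R d) : psd T <-> posmx (hmat T).
Proof.
split=> [[r [p [_ ->]]]|pT].
  by rewrite hmat_sum; apply: posmx_sum => i _; rewrite /= tensE; apply: posmx_outer.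
have [r [P [fP TE]]] := posmx_spectral (herm_adj T) pT.
exists r, [tuple form_of (row i P)^H | i < r]; split.
  apply/freeP => c c0 i.
  (* The forms are adjoints of the rows of [P], hence the conjugated coefficients. *)
  have cP : (\row_j (c j)^*) *m P = 0.
    apply/rowP => j; rewrite [RHS]mxE mxE.
    have := congr1 (fun p => (cvec p j 0)^*) c0.
    rewrite linear0 linear_sum summxE !mxE rmorph0 rmorph_sum => e.
    rewrite -[RHS]e; apply: eq_bigr => l _.
    by rewrite -tnth_nth tnth_mktuple linearZ /= form_ofK !mxE rmorphM /= conjCK.
  have /rowP/(_ i) : \row_j (c j)^* = 0.
    by apply: (row_free_inj fP); rewrite cP mul0mx.
  by rewrite !mxE => /eqP; rewrite conjC_eq0 => /eqP.
apply/val_inj; rewrite /= hmat_sum TE.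
apply/matrixP => i j; rewrite summxE mxE; apply: eq_bigr => l _.
by rewrite tnth_mktuple /= tensE form_ofK adjmxK !mxE big_ord1 !mxE.
Qed.

Lemma mu_eval (T : 'M[C]_d.+1) (s : C) :
  let z := \col_(i < d.+1) s ^+ i in
  (mu T).@[fun k => if k == ord0 then s else 1] = (z^T *m T *m z) 0 0.
Proof.
move=> z; rewrite /mu -mulmxA mxE raddf_sum; apply: eq_bigr => i _ /=.
rewrite raddf_sum !mxE mulr_sumr; apply: eq_bigr => j _ /=.
rewrite mevalZ rmorphM /= !mevalX !big_ord_recl !big_ord0 /= !multinomE.
by rewrite !(tnth_nth 0%N) /= !expr1n !mulr1 !mxE; ring.
Qed.

(** At a real point [(s, 1)], [mu T] is the Hermitian form of [T] at the vector of powers of [s].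
    Its vanishing puts these vectors in the kernel, and the nodes 0 to [d] give a Vandermonde
    basis. *)
Lemma posmx_mu_eq0 (T : herm R d) : posmx (hmat T) -> mu (hmat T) = 0 -> T = 0.
Proof.
move=> pT T0; apply/val_inj => /=; set A := hmat T.
pose a : 'rV[C]_d.+1 := \row_j j%:R.
pose Z := Vandermonde d.+1 a.
have Z_unit : Z \in unitmx.
  rewrite unitmxE det_Vandermonde unitfE; apply/prodf_neq0 => i _.
  apply/prodf_neq0 => j ij; rewrite !mxE subr_eq0 eqr_nat.
  by rewrite neq_ltn ij orbT.
suff AZ : A *m Z = 0 by rewrite -[A](mulmxK Z_unit) AZ mul0mx.
have colZ j : col j Z = \col_(i < d.+1) (j%:R : C) ^+ i.
  by apply/colP => i; rewrite !mxE.
apply/matrixP => i j; have /colP/(_ i) : A *m col j Z = 0.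
  apply: (posmx_null (herm_adj T) pT).
  have := mu_eval A j%:R; rewrite T0 raddf0 -colZ => ->.
  rewrite /sesq; congr ((_ *m _ *m _) 0 0).
  by rewrite colZ; apply/rowP => k; rewrite !mxE rmorphXn /= conjC_nat.
by rewrite colE mulmxA -colE !mxE.
Qed.

Lemma mu_coef (A : 'M[C]_d.+1) (i0 j0 : 'I_d.+1) :
  (mu A)@_(bmon i0 + bmon j0) = \sum_(i < d.+1) \sum_(j < d.+1 | (i + j == i0 + j0)%N) A i j.
Proof.
rewrite /mu raddf_sum; apply: eq_bigr => i _ /=.
rewrite raddf_sum [RHS]big_mkcond; apply: eq_bigr => j _ /=.
rewrite mcoeffZ -mpolyXD mcoeffX.
have -> : (bmon i + bmon j == bmon i0 + bmon j0)%MM = (i + j == i0 + j0)%N.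
  apply/eqP/eqP => [/mnmP/(_ ord0)|e].
    by rewrite !mnmDE !multinomE !(tnth_nth 0%N).
  apply/mnmP => k; rewrite !mnmDE !multinomE !(tnth_nth 0%N).
  have := ltn_ord i; have := ltn_ord j; have := ltn_ord i0; have := ltn_ord j0.
  by case: k => [[|[|k]] hk] //=; lia.
by case: ifP; rewrite ?mulr1 ?mulr0.
Qed.

Lemma mu_eq0 (A : 'M[C]_d.+1) :
  (forall s : 'I_(2 * d).+1, \sum_(i < d.+1) \sum_(j < d.+1 | (i + j == s)%N) A i j = 0) ->
  mu A = 0.
Proof.
move=> A0; apply/mpolyP => m; rewrite mcoeff0.
have [[i0 [j0 ->]]|nm] := pselect (exists i0 j0 : 'I_d.+1, m = (bmon i0 + bmon j0)%MM).
  have lt_s : (i0 + j0 < (2 * d).+1)%N.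
    by have := ltn_ord i0; have := ltn_ord j0; lia.
  by rewrite mu_coef; apply: (A0 (Ordinal lt_s)).
rewrite /mu raddf_sum big1 // => i _; rewrite raddf_sum big1 // => j _ /=.
rewrite mcoeffZ -mpolyXD mcoeffX; case: eqP => [e|_]; last by rewrite mulr0.
by case: nm; exists i, j.
Qed.

End HermitianForms.

(** * Dimension count for Hermitian matrices with zero diagonal *)

Section OffDiagonal.
Variables (R : realType) (d m : nat).
Local Notation C := R[i].
Local Notation "A ^H" := (map_mx Num.conj A^T) (at level 8, format "A ^H").
Variable W : 'M[C]_(d.+1, m).

(* Real square matrices parametrize the Hermitian ones: the symmetric part
   gives the real parts, the antisymmetric part the imaginary parts. *)
Definition herm_of_real (X : 'M[R]_m) : 'M[C]_m :=
  \matrix_(i, j) Complex (X i j + X j i) (X i j - X j i).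

Lemma herm_of_real_linear a (X Y : 'M[R]_m) :
  herm_of_real (a *: X + Y) = (a%:C)%C *: herm_of_real X + herm_of_real Y.
Proof.
apply/matrixP => i j; rewrite !mxE; apply/eqP; rewrite eq_complex /=.
by apply/andP; split; apply/eqP; ring.
Qed.

Lemma herm_of_real_adj X : (herm_of_real X)^H = herm_of_real X.
Proof.
apply/matrixP => i j; rewrite !mxE; apply/eqP; rewrite eq_complex /=.
by apply/andP; split; apply/eqP; ring.
Qed.

Lemma herm_of_real_inj X : herm_of_real X = 0 -> X = 0.
Proof.
move=> X0; apply/matrixP => i j; have /matrixP/(_ i j) := X0.
by rewrite !mxE => /eqP; rewrite eq_complex /= => /andP[/eqP h1 /eqP h2]; lra.
Qed.

(** Appending the diagonal as [m] further coordinates lets all square matrices be the source; the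
    first block holds the real parts of the coefficients of [mu H]. *)
Definition offdiag_map (x : 'rV[R]_(m * m)) : 'rV[R]_((2 * d).+1 + m) :=
  let X := vec_mx x in let H := W *m herm_of_real X *m W^H in
  row_mx (\row_s \sum_(i < d.+1) \sum_(j < d.+1 | (i + j == s)%N) complex.Re (H i j))
         (\row_i X i i).

Fact offdiag_map_is_linear : linear offdiag_map.
Proof.
move=> a x y; rewrite /offdiag_map scale_row_mx add_row_mx; congr row_mx; last first.
  by apply/rowP => i; rewrite !mxE.
apply/rowP => s; rewrite !mxE mulr_sumr -big_split; apply: eq_bigr => i _ /=.
rewrite mulr_sumr -big_split; apply: eq_bigr => j _ /=.
rewrite linearP herm_of_real_linear mulmxDr mulmxDl -scalemxAr -scalemxAl.
rewrite [X in complex.Re X]mxE [X in complex.Re (X + _)]mxE.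
set u := (_ *m _) i j; set v := (_ *m _) i j.
by case: u => ? ?; case: v => ? ? /=; ring.
Qed.
HB.instance Definition _ :=
  GRing.isLinear.Build R _ _ _ offdiag_map offdiag_map_is_linear.

Lemma offdiag_count :
  (forall h : 'M[C]_m, h^H = h -> (forall i, h i i = 0) ->
     mu (W *m h *m W^H) = 0 -> h = 0) ->
  (m * m <= (2 * d).+1 + m)%N.
Proof.
move=> mu_inj; have : row_free (lin1_mx offdiag_map); last first.
  by move=> /eqP <-; apply: rank_leq_col.
apply: inj_row_free => x; rewrite mul_rV_lin1 /= => x0.
have /eq_row_mx[coef0 diag0] : offdiag_map x = row_mx 0 0 by rewrite row_mx0.
rewrite -[x]vec_mxK; set X := vec_mx x in coef0 diag0 *.
suff -> : X = 0 by rewrite linear0.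
apply: herm_of_real_inj; apply: mu_inj => [|i|]; first exact: herm_of_real_adj.
  have /rowP/(_ i) := diag0; rewrite !mxE => ->.
  by apply/eqP; rewrite eq_complex /= addr0 subr0 eqxx.
set H := W *m _ *m _ in coef0 *.
have hH : H^H = H by rewrite !adjmxM adjmxK herm_of_real_adj mulmxA.
apply: mu_eq0 => s; set c := \sum_(_ < _) _.
have Rc : complex.Re c = 0.
  by have /rowP/(_ s) := coef0; rewrite !mxE /c => <-; rewrite raddf_sum;
     apply: eq_bigr => i _; rewrite raddf_sum.
(* Conjugation exchanges [i] and [j], which preserves the antidiagonal; so the sum is real and its
   real part decides. *)
have cc : c^* = c.
  have -> : c = \sum_(i < d.+1) \sum_(j < d.+1) if (i + j == s)%N then H i j else 0.
    by apply: eq_bigr => i _; rewrite big_mkcond.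
  rewrite rmorph_sum [RHS]exchange_big; apply: eq_bigr => i _ /=.
  rewrite rmorph_sum; apply: eq_bigr => j _ /=; rewrite addnC.
  by case: ifP; rewrite ?rmorph0 // -[in RHS]hH !mxE.
move: c Rc cc => [a b] /= -> /eqP; rewrite eq_complex /= => /andP[_ /eqP h].
by apply/eqP; rewrite eq_complex /= eqxx; apply/eqP; lra.
Qed.
End OffDiagonal.

(** * Faces of the Gram spectrahedron *)

Section GramFaces.
Variables (R : realType) (d : nat) (f : {mpoly R[2]}).
Local Notation C := R[i].
Local Notation "A ^H" := (map_mx Num.conj A^T) (at level 8, format "A ^H").
Local Notation K := (hgram d f).
Implicit Types (S T : herm R d).

Lemma real_complex_eq0 (r : R) : ((r%:C)%C == 0 :> C) = (r == 0).
Proof. by rewrite eq_complex /= eqxx andbT. Qed.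

Lemma real_complex_gt0 (r : R) : (0 < (r%:C)%C :> C) = (0 < r).
Proof. by rewrite -(rmorph0 (real_complex R)) ltcR. Qed.

Lemma hmatD S T : hmat (S + T) = hmat S + hmat T. Proof. by []. Qed.
Lemma hmatB S T : hmat (S - T) = hmat S - hmat T. Proof. by []. Qed.
Lemma hmatZ t T : hmat (t *: T) = (t%:C)%C *: hmat T. Proof. by []. Qed.

Lemma hgramP T :
  K T <-> posmx (hmat T) /\ mu (hmat T) = map_mpoly (real_complex R) f.
Proof. by split=> -[/psd_posmx]. Qed.

Lemma hgram_add_ker S T (e : R) : K S -> mu (hmat T) = 0 ->
  posmx (hmat (S + e *: T)) -> K (S + e *: T).
Proof.
move=> /hgramP[_ muS] muT pST; apply/hgramP; split=> //.
by rewrite hmatD hmatZ linearD linearZ /= muT scaler0 addr0.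
Qed.

Lemma sesq_hmatD S T u v : sesq (hmat (S + T)) u v = sesq (hmat S) u v + sesq (hmat T) u v.
Proof. by rewrite /sesq hmatD mulmxDr mulmxDl mxE. Qed.

Lemma sesq_hmatZ t T u v : sesq (hmat (t *: T)) u v = (t%:C)%C * sesq (hmat T) u v.
Proof. by rewrite /sesq hmatZ -scalemxAr -scalemxAl mxE. Qed.

(** A ray direction is killed by [mu], and it is psd since otherwise some form value would become
    negative far out; such a tensor is zero. *)
Lemma hgram_ray_free : ray_free K.
Proof.
move=> S T KST; have KS : K S by have := KST 0 (lexx _); rewrite scale0r addr0.
have /hgramP[_ muS] := KS.
have muT : mu (hmat T) = 0.
  have /hgramP[_] := KST 1 ler01; rewrite scale1r hmatD linearD /= muS => /eqP.
  by rewrite -subr_eq0 addrC addKr => /eqP.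
apply: posmx_mu_eq0 muT => z.
have Rz : sesq (hmat T) z z \is Num.real.
  by apply/CrealP; rewrite sesq_conj ?herm_adj.
have [//|neg] := real_leP (real0 _) Rz.
have [r r0 rE] : exists2 r : R, 0 < r & - sesq (hmat T) z z = (r%:C)%C.
  by apply: pos_complex; rewrite oppr_gt0.
have pS : 0 <= sesq (hmat S) z z by have /hgramP[] := KS.
have [a a0 aE] : exists2 a : R, 0 < a & sesq (hmat S) z z + 1 = (a%:C)%C.
  by apply: pos_complex; rewrite ltr_wpDl.
(* At this time the form at [z] equals -1. *)
have /hgramP[/(_ z)] := KST (a / r) (divr_ge0 (ltW a0) (ltW r0)).
rewrite sesq_hmatD sesq_hmatZ -[sesq (hmat T) z z]opprK rE mulrN -rmorphM /=.
rewrite mulfVK ?gt_eqF // -aE opprD addrA subrr sub0r oppr_ge0 => /(lt_le_trans ltr01).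
by rewrite ltxx.
Qed.

Section FacetVectors.
Variables (F : set (herm R d)) (x0 : herm R d) (m : nat).
Variables (L : 'I_m -> herm R d -> R) (y : 'I_m -> herm R d).
Hypotheses (F_face : is_face K F) (fs : facet_system F x0 L y).

Let FK T : F T -> K T.
Proof. by have [FK _ _] := F_face; apply: FK. Qed.

Let F_posmx T : F T -> posmx (hmat T).
Proof. by move=> /FK/hgramP[]. Qed.

Let F_mu T : F T -> mu (hmat T) = map_mpoly (real_complex R) f.
Proof. by move=> /FK/hgramP[]. Qed.

(* If the kernel of [y i] were contained in that of [x0], the segment from [x0]
   to [y i] could be prolonged inside the Gram spectrahedron, hence inside its
   face [F], contradicting that [y i] lies on a facet. *)
Lemma facet_kernel i : exists u : 'cV[C]_d.+1,
  hmat (y i) *m u = 0 /\ hmat x0 *m u <> 0.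
Proof.
apply: contrapT => nu; have Fy := facet_point fs i; have Fx0 := facet_base fs.
have ker (u : 'cV_d.+1) : hmat (y i) *m u = 0 -> hmat x0 *m u = 0.
  by move=> yu; apply: contrapT => xu; apply: nu; exists u.
have [B hB x0E] := adjmx_factor (herm_adj x0) (herm_adj (y i)) ker.
have [e' e'0 [_]] := posmx_perturb (herm_adj (y i)) (F_posmx Fy) hB.
have [e e0 ->] := pos_complex e'0; rewrite -x0E => pe.
apply: (facet_exit fs (i := i) e0); apply: (face_extend F_face) => //; try exact: FK.
apply: hgram_add_ker; first exact: FK.
  by rewrite hmatB linearB /= !F_mu // subrr.
rewrite scalerBr addrCA hmatD hmatZ hmatB hmatZ => z.
rewrite /sesq mulmxDr mulmxDl mxE addr_ge0 //; last exact: pe.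
by rewrite -scalemxAr -scalemxAl mxE mulr_ge0 ?ler0c ?(ltW e0) //; apply: F_posmx.
Qed.

Lemma facet_vectors : exists u : 'I_m -> 'cV[C]_d.+1,
  [/\ forall i T, F T -> hmat T *m u i = ((L i T)%:C)%C *: (hmat x0 *m u i),
      forall i j, i != j -> sesq (hmat x0) (u i) (u j) = 0
    & forall i, 0 < sesq (hmat x0) (u i) (u i)].
Proof.
have /choice[u uP] := facet_kernel; exists u.
have px0 := F_posmx (facet_base fs).
have ev i T : F T -> hmat T *m u i = ((L i T)%:C)%C *: (hmat x0 *m u i).
  move=> FT; have [e e0 []] := facet_span fs i FT.
  set v := (X in y i + _ *: X) => Fp Fm.
  have [yu _] := uP i.
  have syu w : sesq (hmat (y i)) w (u i) = 0 by rewrite /sesq -mulmxA yu mulmx0 mxE.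
  (* Both [y i + e v] and [y i - e v] are psd and [y i] kills [u i], so the form of [v] at [u i] has
     both signs. *)
  have vu0 : sesq (hmat v) (u i) (u i) = 0.
    have e0C : 0 < (e%:C)%C :> C by rewrite real_complex_gt0.
    have := F_posmx Fp (u i); rewrite sesq_hmatD syu add0r sesq_hmatZ pmulr_rge0 //.
    have := F_posmx Fm (u i); rewrite -scaleNr sesq_hmatD syu add0r sesq_hmatZ.
    rewrite rmorphN mulNr oppr_ge0 pmulr_rle0 // => h1 h2.
    by apply/eqP; rewrite eq_le h1 h2.
  have : hmat (y i + e *: v) *m u i = 0.
    apply: posmx_null (herm_adj _) (F_posmx Fp) _ _.
    by rewrite sesq_hmatD syu sesq_hmatZ vu0 mulr0 addr0.
  rewrite hmatD mulmxDl yu add0r hmatZ -scalemxAl => /eqP.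
  rewrite scaler_eq0 real_complex_eq0 gt_eqF // orFb.
  rewrite /v !hmatB hmatZ hmatB !mulmxBl -scalemxAl mulmxBl yu sub0r scalerN opprK.
  rewrite rmorphB scalerBl rmorph1 scale1r addrA subrK subr_eq0.
  by move=> /eqP.
split=> // [i j ij|i]; last first.
  rewrite lt_neqAle eq_sym px0 andbT; apply/eqP => /(posmx_null (herm_adj x0) px0).
  by have [_] := uP i.
have Fy := facet_point fs j.
have ji : j != i by rewrite eq_sym.
(* The conjugate of this identity is [L i (y j)] times the form of [x0] at [u j], [u i], and that
   factor is nonzero. *)
have yj0 : sesq (hmat (y j)) (u i) (u j) = 0.
  by rewrite /sesq -mulmxA (uP j).1 mulmx0 mxE.
have := congr1 Num.conj yj0; rewrite sesq_conj ?herm_adj // rmorph0.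
rewrite /sesq -mulmxA ev // -scalemxAr mxE mulmxA -/(sesq _ _ _) => /eqP.
rewrite mulf_eq0 real_complex_eq0 (negbTE (facet_point_neq0 fs ji)) /= => /eqP e0.
by rewrite -[LHS]sesq_conj ?herm_adj // /sesq e0 rmorph0.
Qed.

Section WithVectors.
Variable u : 'I_m -> 'cV[C]_d.+1.
Hypotheses
  (uE : forall i T, F T -> hmat T *m u i = ((L i T)%:C)%C *: (hmat x0 *m u i))
  (u_orth : forall i j, i != j -> sesq (hmat x0) (u i) (u j) = 0)
  (u_gt0 : forall i, 0 < sesq (hmat x0) (u i) (u i)).

Lemma facet_count : (m * m <= (2 * d).+1 + m)%N.
Proof.
pose U := \matrix_(a, i) u i a 0.
have colU i : col i U = u i by apply/colP => a; rewrite !mxE.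
have sesqU (A : 'M[C]_d.+1) i j : sesq A (u i) (u j) = (U^H *m A *m U) i j.
  rewrite /sesq -!colU !mxE; apply: eq_bigr => a _; rewrite !mxE; congr (_ * _).
  by apply: eq_bigr => c _; rewrite !mxE.
pose g : 'rV[C]_m := \row_i sesq (hmat x0) (u i) (u i).
have UxU : U^H *m hmat x0 *m U = diag_mx g.
  apply/matrixP => i j; rewrite -sesqU [RHS]mxE; have [->|ij] := eqVneq i j.
    by rewrite mxE.
  by rewrite u_orth.
apply: (@offdiag_count R d m (hmat x0 *m U)) => h hh h0.
set B := U *m h *m U^H.
have hB : B^H = B by rewrite !adjmxM adjmxK hh mulmxA.
(* This shape [x0 B x0] allows a perturbation of [x0] in both directions. *)
have NE : (hmat x0 *m U) *m h *m (hmat x0 *m U)^H = hmat x0 *m B *m hmat x0.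
  by rewrite adjmxM herm_adj /B !mulmxA.
rewrite NE => muN.
have hN : hmat x0 *m B *m hmat x0 \is hermsymmx.
  by apply/hermsymmxP; rewrite 2!adjmxM hB herm_adj mulmxA.
pose N := Herm hN.
have px0 := F_posmx (facet_base fs).
have [e' e'0 [pe me]] := posmx_perturb (herm_adj x0) px0 hB.
have [e e0 eE] := pos_complex e'0; rewrite {e' e'0}eE in pe me.
have FN : F (x0 + e *: N).
  have Kx0 := FK (facet_base fs).
  apply: face_midpoint F_face (facet_base fs) _ _; first exact: hgram_add_ker.
  by rewrite -scaleNr; apply: hgram_add_ker; rewrite // hmatD hmatZ rmorphN scaleNr.
apply/matrixP => i j; rewrite [RHS]mxE.
have [<-|ij] := eqVneq i j; first exact: h0.
have : sesq (hmat N) (u i) (u j) = 0.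
  have : sesq (hmat (x0 + e *: N)) (u i) (u j) = 0.
    rewrite /sesq -mulmxA uE // -scalemxAr mxE mulmxA -/(sesq _ _ _).
    by rewrite u_orth // mulr0.
  rewrite sesq_hmatD u_orth // add0r sesq_hmatZ => /eqP.
  by rewrite mulf_eq0 real_complex_eq0 gt_eqF //= => /eqP.
(* By orthogonality of the [u i] for [x0], this value is [h i j] times two positive numbers. *)
have -> : sesq (hmat N) (u i) (u j) = (diag_mx g *m h *m diag_mx g) i j.
  by rewrite sesqU -UxU /= /B !mulmxA.
rewrite mul_mx_diag mxE mul_diag_mx !mxE => /eqP.
by rewrite !mulf_eq0 !(gt_eqF (u_gt0 _)) orbF /= => /eqP.
Qed.

Hypotheses (F_poly : polyhedron F)
  (ext_rank1 : forall T, extreme_points F T -> has_rank T 1).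

Let F_neq0 T i : F T -> (L i T == 0) = (hmat T *m u i == 0).
Proof.
move=> FT; rewrite uE // scaler_eq0 real_complex_eq0.
case: eqP => //= _; apply/esym/negP => /eqP xu.
by have := u_gt0 i; rewrite /sesq -mulmxA xu mulmx0 mxE ltxx.
Qed.

(** [rank1_sesq] at [u i] gives this identity multiplied by [L i T], which cancels. *)
Lemma extreme_rank1 T i : extreme_points F T -> L i T != 0 ->
  sesq (hmat x0) (u i) (u i) *: hmat T =
  ((L i T)%:C)%C *: ((hmat x0 *m u i) *m (hmat x0 *m u i)^H).
Proof.
move=> eT Li; have [FT _] := eT; have [e [p [_ TE]]] := ext_rank1 eT.
have {}TE : hmat T = (((-1) ^+ e ord0)%:C)%C *: (cvec (tnth p ord0) *m (cvec (tnth p ord0))^H).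
  by rewrite TE big_ord1 hmatZ /= tensE.
have := rank1_sesq (cvec (tnth p ord0)) (u i) (conj_real_complex ((-1) ^+ e ord0)).
rewrite /= -TE (uE i FT) adjmxZ conj_real_complex.
rewrite /sesq -mulmxA (uE i FT) -scalemxAr mxE mulmxA -/(sesq _ _ _).
rewrite -!scalemxAl -scalemxAr -scalerA => /scalerI; apply.
by rewrite real_complex_eq0.
Qed.

Lemma extreme_unique S T i : extreme_points F S -> extreme_points F T ->
  L i S != 0 -> L i T != 0 -> S = T.
Proof.
move=> eS eT LS LT; have [FS _] := eS; have [FT _] := eT.
have g0 := gt_eqF (u_gt0 i).
have LST : ((L i T)%:C)%C *: hmat S = ((L i S)%:C)%C *: hmat T.
  apply: (scalerI (negbT g0)).
  rewrite !scalerA ![_ * (_%:C)%C]mulrC -!scalerA !extreme_rank1 //.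
  by rewrite !scalerA mulrC.
(* If [f] were zero, the psd tensor [S] would vanish, against [L i S != 0]. *)
have fN0 : map_mpoly (real_complex R) f != 0.
  apply/eqP => f0; have /(posmx_mu_eq0 (F_posmx FS)) S0 : mu (hmat S) = 0.
    by rewrite F_mu.
  by move: LS; rewrite F_neq0 // S0 mul0mx eqxx.
have := congr1 (@mu R d) LST; rewrite !linearZ /= !F_mu // => /eqP.
rewrite -subr_eq0 -scalerBl scaler_eq0 (negbTE fN0) orbF subr_eq0.
move=> /eqP e; apply/val_inj => /=; move: LST; rewrite e; apply: scalerI.
by rewrite real_complex_eq0.
Qed.

Lemma extreme_other T i j : extreme_points F T -> L i T != 0 -> i != j ->
  hmat T *m u j = 0.
Proof.
move=> eT Li ij; apply: (scalerI (negbT (gt_eqF (u_gt0 i)))).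
have ij0 : (u i)^H *m hmat x0 *m u j = 0.
  by rewrite [LHS]mx11_scalar -/(sesq _ _ _) u_orth // raddf0.
rewrite scaler0 scalemxAl extreme_rank1 // -scalemxAl -(mulmxA (_ *m _)) adjmxM herm_adj.
by rewrite ij0 mulmx0 scaler0.
Qed.

Lemma face_is_simplex : is_simplex F.
Proof.
have Frf : ray_free F := ray_freeS FK hgram_ray_free.
(* Each [i] in [J] has exactly one vertex with [L i] nonzero, by [extreme_unique]; outside [J] the
   choice defaults to 0. *)
pose J := [pred i | `[< exists T, extreme_points F T /\ L i T != 0 >]].
have /choice[t tP] i : exists T, i \in J -> extreme_points F T /\ L i T != 0.
  by have [/asboolP[T TP]|_] := boolP (i \in J); [exists T | exists 0].
pose v (i : 'I_#|J|) := t (enum_val i).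
have vP i : extreme_points F (v i) /\ L (enum_val i) (v i) != 0.
  exact: tP (enum_valP i).
have ext_v : extreme_points F `<=` range v.
  move=> T eT; have [FT _] := eT; have [i Li] := facet_cap fs FT.
  have iJ : i \in J by apply/asboolP; exists T.
  exists (enum_rank_in iJ i) => //; rewrite /v enum_rankK_in //.
  have [et Lt] := tP _ iJ; exact: extreme_unique et eT Lt Li.
apply: (@is_simplex_ord _ _ _ _ v); first by exists x0; apply: facet_base fs.
  (* Applying the relation to [u (enum_val j)] kills every term but the j-th. *)
  move=> c _ cv j; have [_ Lj] := vP j; have [Fj _] := (vP j).1.
  have := congr1 (fun T : herm R d => hmat T *m u (enum_val j)) cv.
  rewrite hmat_sum mulmx_suml (bigD1 j) //= big1 => [|i ij].
    rewrite addr0 mul0mx -scalemxAl => /eqP; rewrite scaler_eq0 -F_neq0 // (negbTE Lj) orbF.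
    by rewrite real_complex_eq0 => /eqP.
  have [ei Li] := vP i; rewrite -scalemxAl (extreme_other ei Li) ?scaler0 //.
  by rewrite (inj_eq enum_val_inj).
apply/seteqP; split; last first.
  apply: subset_trans (polyhedron_conv_hull F_poly); apply: conv_hullW => _ [i _ <-].
  by have [[]] := vP i.
apply: subset_trans (conv_hullW ext_v).
have [n [l [b FE]]] := F_poly; rewrite FE in Frf *.
exact: ray_free_polyhedron_conv_extreme.
Qed.
End WithVectors.
End FacetVectors.
End GramFaces.

Theorem theorem3p1 (R : realType) (d : nat) (f : {mpoly R[2]})
    (f_hom : f \is (2 * d)%N.-homog) (f_ge0 : nonneg_form f)
    (F : set (herm R d)) (F_face : polyhedral_face (hgram d f) F)
    (k : nat) (F_dim : has_dim F k) :
  ('C(k.+1, 2) <= d)%N /\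
  ((forall theta : herm R d, extreme_points F theta -> has_rank theta 1) ->
   is_simplex F).
Proof.
have [Fface Fpoly [x Fx]] := F_face.
have [k0|k_gt0] := posnP k.
  rewrite k0 in F_dim *; rewrite (dim0_singleton F_dim Fx).
  by split=> // _; apply: set1_is_simplex.
have [FK _ _] := Fface.
have Frf : ray_free F := ray_freeS FK (@hgram_ray_free R d f).
have [m [x0 [L [y [km fs]]]]] :
    exists m x0 (L : 'I_m -> herm R d -> R) y, (k < m)%N /\ facet_system F x0 L y.
  have [n [l [b FE]]] := Fpoly; rewrite FE in Frf F_dim Fx *.
  exact: exists_facet_system Frf _ _ k_gt0 F_dim Fx.
have [u [uE u_orth u_gt0]] := facet_vectors Fface fs.
split; last by move=> r1; apply: face_is_simplex Fface fs u uE u_orth u_gt0 Fpoly r1.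
have := facet_count Fface fs uE u_orth u_gt0.
(* From [k < m] one gets [k (k + 1) <= m (m - 1) <= 2 d + 1]; halving with rounding down absorbs the
   extra 1. *)
rewrite bin2 /= => mm; rewrite -[leqRHS](half_bit_double d true).
apply: half_leq; rewrite -muln2 /=; nia.
Qed.
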